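(* Let $\Delta \in \mathbb{N}$ and let $\lambda^\star>0$. Let $\mathcal{G}$ be a family of graphs of maximum degree at most $\Delta$. If the hard-core model on $\mathcal{G}$ satisfies very strong spatial mixing (VSSM) at $\lambda^\star$, then the hard-core model at fugacity $\lambda^\star$ is spectrally independent on $\mathcal{G}$.
   Context: All graphs are finite and simple; $\mathbb N=\{1,2,\dots\}$. For a graph $G=(V,E)$, $\mathcal I_G$ is the collection of independent sets of $G$. For $\lambda>0$ the hard-core measure on $\mathcal I_G$ is $\mu_{G,\lambda}(I)=\lambda^{|I|}/\sum_{J\in\mathcal I_G}\lambda^{|J|}$; $\mathbf I$ denotes a random independent set with this law. For $v\in V$ and $\ell\in\mathbb N$, $S_G(v,\ell)$ is the set of vertices at distance exactly $\ell$ from $v$ in $G$. Spectral independence: for distinct $u,v\in V$ let $\Psi_{G,\lambda}(u\to v)=\mathbb P[v\in\mathbf I\mid u\in\mathbf I]-\mathbb P[v\in\mathbf I\mid u\notin\mathbf I]$ (probabilities with respect to $\mu_{G,\lambda}$), and let $I_{G,\lambda}$ be the $V\times V$ matrix with $I_{G,\lambda}(u,v)=\Psi_{G,\lambda}(u\to v)$ if $u\ne v$ and $0$ if $u=v$ (its eigenvalues are real). The hard-core model at fugacity $\lambda$ is spectrally independent on a family $\mathcal G$ if there is a constant $\eta>0$ such that for each $G\in\mathcal G$ and each induced subgraph $H$ of $G$ the largest eigenvalue of $I_{H,\lambda}$ is at most $\eta$. Boundary conditions and ratios: a boundary condition on $G$ is a map $\sigma:V_\sigma\to\{0,1\}$ with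 $V_\sigma\subset V$ such that $V_{\sigma,\mathrm{in}}:=\sigma^{-1}(1)$ is independent in $G$. For $v\in V\setminus V_\sigma$ put $$Z^{v\,\mathrm{in}}_{(G,\sigma)}(\lambda)=\sum_{\substack{v\in I\subseteq V\setminus V_\sigma\\ I\cup V_{\sigma,\mathrm{in}}\in\mathcal I_G}}\lambda^{|I|},\qquad Z^{v\,\mathrm{out}}_{(G,\sigma)}(\lambda)=\sum_{\substack{v\notin I\subseteq V\setminus V_\sigma\\ I\cup V_{\sigma,\mathrm{in}}\in\mathcal I_G}}\lambda^{|I|},\qquad R_{(G,\sigma),v}(\lambda)=\frac{Z^{v\,\mathrm{in}}_{(G,\sigma)}(\lambda)}{Z^{v\,\mathrm{out}}_{(G,\sigma)}(\lambda)}.$$ Tree of self avoiding walks: fix a total ordering of the vertices of $G$ (inherited by induced subgraphs). For a vertex $v$ of $G$ the rooted tree $T_{\mathrm{SAW}(G,v)}$ (with root $v$) is defined recursively. If the component of $G$ containing $v$ is $\{v\}$, then $T_{\mathrm{SAW}(G,v)}$ is the single vertex $v$. Otherwise let $v_1,\dots,v_d$ be the neighbours of $v$ in $G$ (listed in increasing order), let $G_i$ be obtained from $G$ by removing $v,v_1,\dots,v_{i-1}$, and let $T_i=T_{\mathrm{SAW}(G_i,v_i)}$; then $T_{\mathrm{SAW}(G,v)}$ is obtained from the disjoint union of $T_1,\dots,T_d$ by adding a root vertex $v$ joined to the root $v_i$ of each $T_i$. VSSM: the hard-core model on a family $\mathcal G$ of bounded degree graphs satisfies VSSM at $\lambda>0$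 if there exist constants $\alpha\in[0,1)$ and $C>0$ such that for all $G\in\mathcal G$, every induced subgraph $H$ of $G$, every $v\in V(H)$, every $\ell\in\mathbb N$ and all boundary conditions $\sigma,\tau:S_{T}(v,\ell)\to\{0,1\}$ with $T=T_{\mathrm{SAW}(H,v)}$, we have $|R_{(T,\sigma),v}(\lambda)-R_{(T,\tau),v}(\lambda)|\le C\alpha^\ell$. *)

(* Defs.v *)
(* MathComp world; the reals are an arbitrary [R : realType]. *)
From HB Require Import structures.
From mathcomp Require Import all_boot all_order all_algebra.
From mathcomp Require Import boolp reals.
Set Implicit Arguments.
Unset Strict Implicit.
Unset Printing Implicit Defensive.
Import Order.TTheory GRing.Theory Num.Theory.
Local Open Scope ring_scope.

Record sgraph := SGraph {
  vertex :> finType;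
  edge : rel vertex;
  edge_sym : symmetric edge;
  edge_irr : irreflexive edge }.

Definition max_degree_le (G : sgraph) (D : nat) : Prop :=
  forall v : G, (#|[set w : G | edge v w]| <= D)%N.

Definition indep (G : sgraph) (I : {set G}) : bool :=
  [forall u in I, forall w in I, ~~ edge u w].

Section Induced.
Variables (G : sgraph) (S : {set G}).

Definition induced_edge : rel {x : G | x \in S} :=
  fun x y => edge (val x) (val y).

Lemma induced_edge_sym : symmetric induced_edge.
Proof. by move=> x y; apply: edge_sym. Qed.

Lemma induced_edge_irr : irreflexive induced_edge.
Proof. by move=> x; apply: edge_irr. Qed.

Definition induced : sgraph := SGraph induced_edge_sym induced_edge_irr.
End Induced.

Definition walk (G : sgraph) (n : nat) (v w : G) : bool :=
  [exists p : n.-tuple G, path (@edge G) v p && (last v p == w)].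

Definition sphere (G : sgraph) (v : G) (l : nat) : {set G} :=
  [set w : G | walk l v w && [forall k : 'I_l, ~~ walk k v w]].

Section HardCore.
Variables (R : realType) (G : sgraph) (lambda : R).

Definition hardcore (I : {set G}) : R :=
  lambda ^+ #|I| / \sum_(J : {set G} | indep J) lambda ^+ #|J|.

Definition hc_prob (A : pred {set G}) : R :=
  \sum_(I : {set G} | indep I && A I) hardcore I.

Definition hc_cond_prob (A B : pred {set G}) : R :=
  hc_prob [predI A & B] / hc_prob B.

Definition influence (u v : G) : R :=
  hc_cond_prob (fun I => v \in I) (fun I => u \in I)
  - hc_cond_prob (fun I => v \in I) (fun I => u \notin I).

(* The vertices of G are numbered by [enum_val]. *)
Definition influence_matrix : 'M[R]_#|G| :=
  \matrix_(i, j)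
    if i == j then 0 else influence (enum_val i) (enum_val j).

End HardCore.

(* The eigenvalues of the influence matrix are all real, so bounding the
   largest one amounts to bounding every real eigenvalue. *)
Definition spectrally_independent (R : realType) (F : sgraph -> Prop)
    (lambda : R) : Prop :=
  exists eta : R, 0 < eta /\
    forall (G : sgraph) (S : {set G}) (a : R), F G ->
      eigenvalue (influence_matrix (induced S) lambda) a -> a <= eta.

(* A map sigma : V_sigma -> {0,1} with V_sigma a subset of V is encoded as
   [s : G -> option bool], where [s v = None] means that v is not in V_sigma. *)
Section Boundary.
Variables (G : sgraph) (s : G -> option bool).

Definition bc_dom : {set G} := [set v | s v != None].
Definition bc_in : {set G} := [set v | s v == Some true].
Definition boundary_condition : Prop := indep bc_in.

Variables (R : realType) (lambda : R) (v : G).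

Definition Z_in : R :=
  \sum_(I : {set G} | [&& v \in I, I \subset ~: bc_dom & indep (I :|: bc_in)])
    lambda ^+ #|I|.

Definition Z_out : R :=
  \sum_(I : {set G} | [&& v \notin I, I \subset ~: bc_dom
                        & indep (I :|: bc_in)])
    lambda ^+ #|I|.

Definition ratio : R := Z_in / Z_out.
End Boundary.

Record rgraph := RGraph { rgraph_graph :> sgraph; root : rgraph_graph }.

(* Disjoint union of the rooted graphs [T i], plus a new root [None] joined
   to the root of each [T i]. *)
Section Graft.
Variables (I : finType) (T : I -> rgraph).

Definition graft_edge : rel (option {i : I & T i}) :=
  fun x y =>
    match x, y with
    | None, None => false
    | None, Some y => tagged y == root (T (tag y))
    | Some x, None => tagged x == root (T (tag x))
    | Some x, Some y => (tag x == tag y) && edge (tagged x) (tagged_as x y)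
    end.

Lemma graft_edge_sym : symmetric graft_edge.
Proof.
move=> [[i x]|] [[j y]|] //=; rewrite eq_sym; case: eqP => //= eji; subst j.
by rewrite !tagged_asE edge_sym.
Qed.

Lemma graft_edge_irr : irreflexive graft_edge.
Proof. by move=> [[i x]|] //=; rewrite eqxx tagged_asE edge_irr. Qed.

Definition graft : rgraph :=
  RGraph (None : SGraph graft_edge_sym graft_edge_irr).
End Graft.

Definition total_order (T : Type) (le : rel T) : Prop :=
  [/\ total le, antisymmetric le & transitive le].

Section SAW.
Variables (G : sgraph) (le : rel G).

(* The vertices remaining in G[S] once v and the neighbours of v that are
   smaller than w have been removed. *)
Definition saw_rest (S : {set G}) (v w : G) : {set G} :=
  [set u in S | (u != v) && ~~ [&& edge v u, le u w & u != w]].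

Definition saw_nbr (S : {set G}) (v : G) : finType :=
  {w : G | (w \in S) && edge v w}.

(* The number n is fuel: every recursive call removes v from S, so for v in S
   any n >= #|S| gives the same tree. *)
Fixpoint saw_rec (n : nat) (S : {set G}) (v : G) : rgraph :=
  if n is n'.+1 then
    graft (fun w : saw_nbr S v => saw_rec n' (saw_rest S v (val w)) (val w))
  else graft (fun i : void => match i with end).

(* The tree of self avoiding walks of the induced subgraph G[S], rooted at
   v in S, for the ordering of S inherited from G. *)
Definition saw_tree (S : {set G}) (v : G) : rgraph := saw_rec #|S| S v.

Lemma saw_rest_self (S : {set G}) (v w : G) :
  (w \in S) && edge v w -> w \in saw_rest S v w.
Proof.
case/andP=> wS vw; rewrite inE wS eqxx !andbF andbT.
by apply: contraTneq vw => ->; rewrite edge_irr.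
Qed.

Lemma card_saw_rest (S : {set G}) (v w : G) :
  v \in S -> (#|saw_rest S v w| < #|S|)%N.
Proof.
move=> vS; apply: proper_card; apply/properP; split.
  by apply/subsetP => u; rewrite inE => /andP[].
by exists v; rewrite ?inE ?eqxx ?andbF.
Qed.

Lemma saw_rec_fuel (n : nat) (S : {set G}) (v : G) :
  v \in S -> (#|S| <= n)%N -> saw_rec n S v = saw_tree S v.
Proof.
rewrite /saw_tree; move: {2 4}#|S| (leqnn #|S|) => m.
elim: n m S v => [|n IHn] [|m] S v Sm vS Sn //.
- by move: Sn; rewrite leqn0 cards_eq0 => /eqP S0; rewrite S0 inE in vS.
- by move: Sm; rewrite leqn0 cards_eq0 => /eqP S0; rewrite S0 inE in vS.
rewrite /=; congr graft; apply/functional_extensionality_dep => w.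
have lt := card_saw_rest (val w) vS.
apply: IHn; first by rewrite -ltnS (leq_trans lt).
  exact: saw_rest_self (valP w).
by rewrite -ltnS (leq_trans lt).
Qed.

Lemma saw_treeE (S : {set G}) (v : G) : v \in S ->
  saw_tree S v =
  graft (fun w : saw_nbr S v => saw_tree (saw_rest S v (val w)) (val w)).
Proof.
move=> vS; have := erefl (saw_tree S v); rewrite {1}/saw_tree.
case E: #|S| => [|n] <- /=.
  by move/eqP: E; rewrite cards_eq0 => /eqP S0; rewrite S0 inE in vS.
congr graft; apply/functional_extensionality_dep => w.
apply: saw_rec_fuel; first exact: saw_rest_self (valP w).
by rewrite -ltnS -E card_saw_rest.
Qed.

End SAW.

Definition VSSM (R : realType) (F : sgraph -> Prop)
    (le : forall G : sgraph, rel G) (lambda : R) : Prop :=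
  exists alpha C : R, [/\ 0 <= alpha, alpha < 1, 0 < C &
    forall (G : sgraph) (S : {set G}) (v : G) (l : nat),
      F G -> v \in S -> (0 < l)%N ->
      let T := saw_tree (le G) S v in
      forall s t : T -> option bool,
        boundary_condition s -> boundary_condition t ->
        bc_dom s = sphere (root T) l -> bc_dom t = sphere (root T) l ->
        `|ratio s lambda (root T) - ratio t lambda (root T)|
          <= C * alpha ^+ l].

(* Main.v *)
Require Import Defs.
From mathcomp Require Import all_boot all_order all_algebra.
From mathcomp Require Import boolp reals sequences exp.
From mathcomp Require Import lra ring.
Set Implicit Arguments.
Unset Strict Implicit.
Unset Printing Implicit Defensive.
Import Defs Order.TTheory GRing.Theory Num.Theory.
Local Open Scope ring_scope.

(** Why very strong spatial mixing gives spectral independence.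

    Let Z(S) be the hard-core partition function of the subgraph induced on a
    vertex set S, and let r(S,u) = lambda Z(S - N[u]) / Z(S - u) be the ratio
    at u.  Removing the neighbours of u one after the other, in increasing
    order, turns Z(S - N[u]) / Z(S - u) into a telescoping product; its factors
    are 1 / (1 + r(S_w,w)), where the pairs (S_w,w) are exactly the children
    of (S,u) in the tree of self avoiding walks.  Hence r is a fixed point of
    the tree recursion f(x) = lambda prod_y 1 / (1 + f(y)), y a child of x
    ([pair_ratio_rec]).  Telescoping occupation probabilities in the same way
    shows that the influence of u on v in G[S] is
    - sum_w p_w ([v = w] + influence of w on v in G[S_w]), where
    p = r / (1 + r) ([del_influence_rec]).  Unfolding this, the sum over v of
    the absolute influences of u is at most the sum over levels l >= 1 of
    A_l(x), the total over the nodes at depth l below x = (S,u) of the products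
    of the p's along the path from x ([del_influence_sum_le]).

    The number of nodes at depth l may grow like Delta^l, so mixing has to
    control the whole level sum A_l and not just its terms.  The gap between r
    and the ratio U_l obtained by making the entire level l unoccupied does
    this.  On a tree all the nodes of one level move the root in the same
    direction, so their effects add up without cancellation, and Bernoulli's
    inequality prod (1 + a_y) >= 1 + sum a_y gives
        sum_y p_y |U_l(y) - r(y)| / r(y)
          <= (1 + c alpha^(l+1)) |U_(l+1)(x) - r(x)| / r(x)
    ([path_weight_step]).  The only loss is the factor r(x) / U_(l+1)(x), which
    mixing bounds by 1 + c alpha^(l+1): r lies between the ratios for the
    all-out and the all-in conditions ([level_ratio_sandwich]), and the bounded
    degree keeps ratios away from 0.  Iterating down to level 0, where U_0 = 0
    and the relative gap equals 1, yields
        A_l <= prod_j (1 + c alpha^j) * c alpha^l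
            <= exp(c / (1 - alpha)) * c alpha^l,
    and the sum over l converges ([path_weight_sum]).

    It remains to see that the two extreme conditions on a sphere of the tree
    have the ratios produced by the recursion ([ratio_saw_level]), since the
    partition function of a graft factors over its branches
    ([part_fun_graft]), and that an eigenvalue is at most the largest absolute
    row sum ([eigenvalue_le_row_sum]). *)

(** * Level sums of a mixing tree recursion *)

Section TreeRecursion.
Variables (R : realType) (X : Type) (ch : X -> seq X) (lambda : R).

Definition ratio_step (f : X -> R) (x : X) : R :=
  lambda * \prod_(y <- ch x) (1 + f y)^-1.

(** The ratio at the root when every node at depth l + 1 is occupied (b true) or
    unoccupied (b false): an occupied child makes the ratio vanish and an
    unoccupied one contributes the factor 1. *)
Definition level_ratio (b : bool) (l : nat) : X -> R :=
  iter l ratio_step (fun x => lambda * \prod_(y <- ch x) (~~ b)%:R).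

Hypothesis lambda_gt0 : 0 < lambda.

Lemma ratio_step_gt0 f x : (forall y, 0 <= f y) -> 0 < ratio_step f x.
Proof.
move=> f_ge0; apply: mulr_gt0 => //; apply: prodr_gt0 => y _.
by rewrite invr_gt0 ltr_wpDr.
Qed.

Lemma level_ratio_ge0 b l x : 0 <= level_ratio b l x.
Proof.
elim: l x => [|l IHl] x /=; last exact/ltW/ratio_step_gt0.
by rewrite mulr_ge0 ?(ltW lambda_gt0) // prodr_ge0.
Qed.

Lemma ratio_step_anti f g x : (forall y, 0 <= f y <= g y) ->
  ratio_step g x <= ratio_step f x.
Proof.
move=> fg; rewrite ler_pM2l //; apply: ler_prod => y _.
have /andP[f0 fgy] := fg y; have g0 := le_trans f0 fgy.
by rewrite invr_ge0 addr_ge0 //= lef_pV2 ?posrE ?ltr_wpDr // lerD2l.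
Qed.

Lemma ratio_step_out : ratio_step (fun=> 0) = level_ratio false 0.
Proof.
by apply/funext => x; congr (_ * _); apply: eq_bigr => y _; rewrite addr0 invr1.
Qed.

Lemma prod_1D_ge (s : seq X) (a : X -> R) : (forall y, 0 <= a y) ->
  1 + \sum_(y <- s) a y <= \prod_(y <- s) (1 + a y).
Proof.
move=> a0; elim: s => [|y s IHs]; first by rewrite !big_nil addr0.
have sum_ge0 : 0 <= \sum_(z <- s) a z by apply: sumr_ge0.
by rewrite !big_cons; have := a0 y; nra.
Qed.

(** The quotient of the two steps is the product over y of
    1 + (g y - f y) / (1 + f y), to which Bernoulli's inequality applies because
    the differences g y - f y all have the same sign. *)
Lemma ratio_step_gap f g x : (forall y, 0 <= f y <= g y) ->
  \sum_(y <- ch x) (g y - f y) / (1 + f y) <=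
    ratio_step f x / ratio_step g x - 1.
Proof.
move=> fg; rewrite lerBrDl.
have f0 y : 0 < 1 + f y by have /andP[f0 _] := fg y; rewrite ltr_wpDr.
have g0 y : 0 < 1 + g y.
  by have /andP[f0' fgy] := fg y; rewrite ltr_wpDr // (le_trans f0').
have -> : ratio_step f x / ratio_step g x =
    \prod_(y <- ch x) (1 + (g y - f y) / (1 + f y)).
  rewrite /ratio_step -mulf_div divff ?gt_eqF // mul1r -prodf_div.
  apply: eq_bigr => y _; rewrite invrK.
  by field; rewrite gt_eqF.
apply: prod_1D_ge => y; have /andP[_ fgy] := fg y.
by rewrite divr_ge0 ?subr_ge0 // ltW.
Qed.

Variable r : X -> R.
Hypothesis r_ge0 : forall x, 0 <= r x.
Hypothesis r_fix : forall x, r x = ratio_step r x.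

(** The total weight of the descending paths of length l, each node y after the
    start contributing its occupation probability r y / (1 + r y). *)
Fixpoint path_weight (l : nat) (x : X) : R :=
  if l is l'.+1 then
    \sum_(y <- ch x) r y / (1 + r y) * path_weight l' y
  else 1.

(** The all-out ratio with the level counted from the node itself.  Level 0 has
    ratio 0, which starts the induction with relative gap 1. *)
Definition out_ratio (l : nat) : X -> R := iter l ratio_step (fun=> 0).

Lemma out_ratioS l : out_ratio l.+1 = level_ratio false l.
Proof. by rewrite /out_ratio iterSr ratio_step_out. Qed.

Lemma out_ratio_ge0 l x : 0 <= out_ratio l x.
Proof. by case: l => [|l] //; rewrite out_ratioS level_ratio_ge0. Qed.

(** The occupation of the deepest level moves the root up or down according to
    the parity of the depth, because every step of the recursion is antitone. *)
Lemma level_ratio_sandwich l x :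
  if odd l then level_ratio false l x <= r x <= level_ratio true l x
  else level_ratio true l x <= r x <= level_ratio false l x.
Proof.
elim: l x => [|l IHl] x.
  rewrite -ratio_step_out [r x]r_fix /=; apply/andP; split; last first.
    by apply: ratio_step_anti => y; rewrite lexx r_ge0.
  rewrite ler_pM2l //; apply: ler_prod => y _.
  by rewrite lexx invr_ge0 addr_ge0.
rewrite /= [r x]r_fix; case: (odd l) IHl => IHl /=; apply/andP; split;
  apply: ratio_step_anti => y; rewrite ?r_ge0 ?level_ratio_ge0 //=;
  by case/andP: (IHl y).
Qed.

Lemma out_ratio_compare l x :
  if odd l then r x <= out_ratio l x else out_ratio l x <= r x.
Proof.
case: l => [|l]; first exact: r_ge0.
rewrite out_ratioS /=; have := level_ratio_sandwich l x.
by case: (odd l) => /andP[].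
Qed.

Variables (Delta : nat) (alpha C : R).
Hypothesis alpha_ge0 : 0 <= alpha.
Hypothesis alpha_lt1 : alpha < 1.
Hypothesis C_gt0 : 0 < C.
Hypothesis ch_size : forall x, (size (ch x) <= Delta)%N.
Hypothesis mixing : forall l x,
  `|level_ratio false l x - level_ratio true l x| <= C * alpha ^+ l.+1.

Lemma out_ratio_close l x : `|out_ratio l.+1 x - r x| <= C * alpha ^+ l.+1.
Proof.
apply: le_trans (mixing l x); rewrite out_ratioS.
have := level_ratio_sandwich l x; case: (odd l) => /andP[h1 h2].
  by rewrite !ler0_norm ?subr_le0 ?(le_trans h1) // lerN2 lerD2l lerN2.
by rewrite !ger0_norm ?subr_ge0 ?(le_trans h1) // lerD2l lerN2.
Qed.

(** A node with at most Delta children, each of ratio at most lambda, has at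
    least this ratio. *)
Definition ratio_lb : R := lambda * (1 + lambda) ^- Delta.

Lemma ratio_lb_gt0 : 0 < ratio_lb.
Proof. by rewrite mulr_gt0 // invr_gt0 exprn_gt0 // addr_gt0. Qed.

Lemma ratio_step_lb f x : (forall y, 0 <= f y <= lambda) ->
  ratio_lb <= ratio_step f x.
Proof.
move=> f_le; rewrite ler_pM2l //.
have l1 : 0 < 1 + lambda by rewrite addr_gt0.
have le1 : (1 + lambda)^-1 <= 1 by rewrite invf_le1 // lerDl ltW.
apply: (@le_trans _ _ (\prod_(y <- ch x) (1 + lambda)^-1)).
  rewrite big_const_seq count_predT -Monoid.iteropE -/(_ ^+ _) -exprVn.
  by rewrite ler_wiXn2l ?invr_ge0 // ltW.
apply: ler_prod => y _; have /andP[f0 fl] := f_le y.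
have f1 : 0 < 1 + f y by rewrite ltr_wpDr.
by rewrite invr_ge0 (ltW l1) lef_pV2 ?posrE // lerD2l.
Qed.

Lemma ratio_step_le f x : (forall y, 0 <= f y) -> ratio_step f x <= lambda.
Proof.
move=> f0; rewrite -[leRHS]mulr1 ler_pM2l //; apply: prodr_ile1 => y _.
by rewrite invr_ge0 addr_ge0 //= invf_le1 ?ltr_wpDr // lerDl.
Qed.

Lemma ratio_lb_out l x : ratio_lb <= out_ratio l.+1 x.
Proof.
apply: ratio_step_lb => y; rewrite out_ratio_ge0 /=.
case: l => [|l]; first exact: ltW.
by apply: ratio_step_le => z; apply: out_ratio_ge0.
Qed.

Lemma ratio_lb_fix x : ratio_lb <= r x.
Proof.
rewrite r_fix; apply: ratio_step_lb => y; rewrite r_ge0 r_fix /=.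
exact: ratio_step_le.
Qed.

(** Dividing by the lower bound on ratios turns the absolute mixing rate into a
    relative one. *)
Definition relative_mixing : R := C / ratio_lb.
Local Notation c := relative_mixing.

Lemma relative_mixing_ge0 : 0 <= c.
Proof. by rewrite divr_ge0 ?ltW ?ratio_lb_gt0.
Qed.

Lemma mixing_term_ge0 j : 0 <= c * alpha ^+ j.
Proof. exact: mulr_ge0 relative_mixing_ge0 (exprn_ge0 j alpha_ge0). Qed.

(** One level of the recursion.  If level l raises the children, the gap lemma
    bounds the sum by r x / U - 1 = (r x / U) * (r x - U) / r x, with U the
    all-out ratio at x, and mixing bounds the factor r x / U.  If it lowers
    them, the gap lemma bounds the sum by U / r x - 1 without loss. *)
Lemma path_weight_step l x :
  \sum_(y <- ch x) r y / (1 + r y) * (`|out_ratio l y - r y| / r y) <=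
  (1 + c * alpha ^+ l.+1) * (`|out_ratio l.+1 x - r x| / r x).
Proof.
have r0 y : 0 < r y := lt_le_trans ratio_lb_gt0 (ratio_lb_fix y).
have r1 y : 0 < 1 + r y by rewrite ltr_wpDr.
have u0 : 0 < out_ratio l.+1 x := lt_le_trans ratio_lb_gt0 (ratio_lb_out l x).
have weightE y : r y / (1 + r y) * (`|out_ratio l y - r y| / r y) =
    `|out_ratio l y - r y| / (1 + r y) by field; rewrite !gt_eqF.
under eq_bigr do rewrite weightE.
have := out_ratio_compare l.+1 x; rewrite [odd _]/=.
case: (boolP (odd l)) => /= odd_l cmp.
- have cmpl y : r y <= out_ratio l y.
    by have := out_ratio_compare l y; rewrite odd_l.
  under eq_bigr do rewrite ger0_norm ?subr_ge0 //.
  apply: le_trans (@ratio_step_gap r _ x _) _ => [y|].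
    by rewrite r_ge0 cmpl.
  rewrite -[ratio_step r x]r_fix -/(out_ratio l.+1 x).
  rewrite ler0_norm ?subr_le0 // opprB.
  have -> : r x / out_ratio l.+1 x - 1 =
      (1 + (r x - out_ratio l.+1 x) / out_ratio l.+1 x) *
      ((r x - out_ratio l.+1 x) / r x).
    move: (r0 x) u0; move: (r x) (out_ratio _ x) => a b a0 b0.
    by field; rewrite !gt_eqF.
  rewrite ler_wpM2r ?divr_ge0 ?subr_ge0 //.
  rewrite lerD2l ler_pdivrMr // mulrAC.
  have := out_ratio_close l x; rewrite ler0_norm ?subr_le0 // opprB.
  move/le_trans; apply; rewrite ler_wpM2r ?exprn_ge0 //.
  rewrite /c -mulrA ler_peMr ?(ltW C_gt0) //.
  by rewrite mulrC ler_pdivlMr ?ratio_lb_gt0 // mul1r ratio_lb_out.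
- have cmpl y : out_ratio l y <= r y.
    by have := out_ratio_compare l y; rewrite (negbTE odd_l).
  under eq_bigr do rewrite ler0_norm ?subr_le0 // opprB.
  apply: (@le_trans _ _ (`|out_ratio l.+1 x - r x| / r x)); last first.
    by rewrite ler_peMl ?divr_ge0 // lerDl mixing_term_ge0.
  rewrite ger0_norm ?subr_ge0 // mulrBl divff ?gt_eqF // [in leRHS]r_fix.
  apply: le_trans (@ratio_step_gap _ r x _) => [|y]; last first.
    by rewrite out_ratio_ge0 cmpl.
  apply: ler_sum => y _; rewrite ler_wpM2l ?subr_ge0 //.
  by rewrite lef_pV2 ?posrE ?ltr_wpDr ?out_ratio_ge0 // lerD2l.
Qed.

(** Iterating the previous step; the relative gap at level 0 is 1, so the level
    sum itself is bounded. *)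
Lemma path_weight_gap l x :
  path_weight l x <=
  (\prod_(j < l) (1 + c * alpha ^+ j.+1)) * (`|out_ratio l x - r x| / r x).
Proof.
have fac0 j : 0 <= 1 + c * alpha ^+ j.
  by rewrite addr_ge0 // mixing_term_ge0.
elim: l x => [|l IHl] x.
  rewrite big_ord0 mul1r /= sub0r normrN ger0_norm // divff //.
  by rewrite gt_eqF // (lt_le_trans ratio_lb_gt0) ?ratio_lb_fix.
rewrite big_ord_recr /= -mulrA.
have := path_weight_step l x; set g := (X in _ <= X) => step.
apply: (le_trans _ (ler_wpM2l _ step)); last by apply: prodr_ge0.
rewrite mulr_sumr; apply: ler_sum => y _.
by rewrite mulrCA ler_wpM2l ?divr_ge0 ?addr_ge0.
Qed.

Lemma geometric_sum_le n : \sum_(j < n) alpha ^+ j <= (1 - alpha)^-1.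
Proof.
rewrite -[leRHS]mul1r ler_pdivlMr ?subr_gt0 // mulrC -opprB mulNr -subrX1 opprB.
by rewrite gerBl exprn_ge0.
Qed.

Definition influence_bound : R := c * expR (c / (1 - alpha)) / (1 - alpha).

Lemma influence_bound_gt0 : 0 < influence_bound.
Proof.
by rewrite divr_gt0 ?subr_gt0 // mulr_gt0 ?expR_gt0 // divr_gt0 ?ratio_lb_gt0.
Qed.

(** The losses accumulate to at most exp (c / (1 - alpha)), while the relative
    gap at depth l is at most c alpha^l. *)
Lemma path_weight_sum n x :
  \sum_(l < n) path_weight l.+1 x <= influence_bound.
Proof.
have prod_le l :
    \prod_(j < l) (1 + c * alpha ^+ j.+1) <= expR (c / (1 - alpha)).
  apply: (@le_trans _ _ (\prod_(j < l) expR (c * alpha ^+ j))).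
    apply: ler_prod => j _; rewrite addr_ge0 ?mixing_term_ge0 //=.
    apply: le_trans (expR_ge1Dx _).
    rewrite lerD2l ler_wpM2l ?relative_mixing_ge0 //.
    by rewrite exprS ler_piMl ?exprn_ge0 // ltW.
  rewrite -expR_sum ler_expR -mulr_sumr ler_wpM2l ?relative_mixing_ge0 //.
  exact: geometric_sum_le.
apply: (@le_trans _ _ (\sum_(l < n) c * expR (c / (1 - alpha)) * alpha ^+ l)).
  apply: ler_sum => l _; apply: le_trans (path_weight_gap _ _) _.
  have r0 : 0 < r x := lt_le_trans ratio_lb_gt0 (ratio_lb_fix x).
  rewrite -[leRHS]mulrA [leRHS]mulrCA ler_pM ?divr_ge0 ?prodr_ge0 //.
    by move=> j _; rewrite addr_ge0 // mixing_term_ge0.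
  rewrite ler_pdivrMr //; apply: le_trans (out_ratio_close l x) _.
  rewrite mulrAC ler_pM ?(ltW C_gt0) ?exprn_ge0 //; last first.
    by rewrite exprS ler_piMl ?exprn_ge0 // ltW.
  rewrite /relative_mixing mulrAC ler_pdivlMr ?ratio_lb_gt0 //.
  by rewrite ler_wpM2l ?ratio_lb_fix ?(ltW C_gt0).
rewrite -mulr_sumr ler_wpM2l ?geometric_sum_le //.
by rewrite mulr_ge0 ?relative_mixing_ge0 ?expR_ge0.
Qed.
End TreeRecursion.

(** * Partition functions of vertex subsets *)
Section PartitionFunction.
Variables (R : realType) (lambda : R).
Hypothesis lambda_gt0 : 0 < lambda.
Variable G : sgraph.
Implicit Types (S I J : {set G}) (u v w : G).

Definition closed_nbhd u : {set G} := [set w | (w == u) || edge u w].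

Definition part_fun S : R :=
  \sum_(I : {set G} | (I \subset S) && indep I) lambda ^+ #|I|.

Lemma indepP I :
  reflect {in I &, forall u w, ~~ edge u w} (indep I).
Proof.
apply: (iffP forall_inP) => [h u w uI wI | h u uI]; last first.
  by apply/forall_inP => w wI; apply: h.
by have /forall_inP/(_ w wI) := h u uI.
Qed.

Lemma indep0 : indep (set0 : {set G}).
Proof. by apply/indepP => u w; rewrite inE. Qed.

Lemma part_fun_gt0 S : 0 < part_fun S.
Proof.
rewrite /part_fun (bigD1 set0) /=; last by rewrite sub0set indep0.
rewrite cards0 expr0 ltr_wpDr // sumr_ge0 // => I _.
by rewrite exprn_ge0 // ltW.
Qed.

Lemma part_fun0 : part_fun set0 = 1.
Proof.
rewrite /part_fun (big_pred1 set0) ?cards0 ?expr0 // => I.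
by rewrite subset0 /=; case: eqP => // ->; rewrite indep0.
Qed.

(** An independent set containing u is u together with an independent set that
    avoids the closed neighbourhood of u. *)
Lemma indep_sum_in S u (F : {set G} -> R) : u \in S ->
  \sum_(I : {set G} | [&& I \subset S, indep I & u \in I]) F I =
  \sum_(I : {set G} | (I \subset S :\: closed_nbhd u) && indep I) F (u |: I).
Proof.
move=> uS.
rewrite (reindex_onto (fun I => u |: I) (fun I => I :\ u)); last first.
  by move=> I /and3P[_ _ uI]; rewrite setD1K.
apply: eq_bigl => I; rewrite setU11 andbT.
have [uI|uI] := boolP (u \in I).
  rewrite [in RHS]subsetD disjoint_sym disjoints_subset.
  have -> : (closed_nbhd u \subset ~: I) = false.
    by apply/negbTE/subsetPn; exists u; rewrite !inE ?eqxx ?uI.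
  rewrite andbF /=; apply/negbTE; rewrite negb_and; apply/orP; right.
  by apply: contraTneq uI => <-; rewrite !inE eqxx.
rewrite setU1K // eqxx andbT; apply/andP/andP => -[].
- rewrite subUset sub1set uS /= => /subsetP IS /indepP uIi; split.
    apply/subsetP => w wI; rewrite !inE IS // andbT negb_or.
    rewrite (contraTneq _ wI) => [/=|->//].
    by apply: uIi; rewrite !inE ?eqxx ?wI ?orbT.
  by apply/indepP => v w vI wI; apply: uIi; rewrite !inE ?vI ?wI orbT.
- move/subsetP => IS /indepP Ii; split.
    rewrite subUset sub1set uS /=; apply/subsetP => w /IS.
    by rewrite !inE => /andP[].
  have nbr w : w \in I -> ~~ edge u w.
    by move/IS; rewrite !inE negb_or => /andP[/andP[]].
  apply/indepP => v w /setU1P[->|vI] /setU1P[->|wI].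
  + by rewrite edge_irr.
  + exact: nbr.
  + by rewrite edge_sym nbr.
  + exact: Ii.
Qed.

Lemma indep_sum_out S u (F : {set G} -> R) :
  \sum_(I : {set G} | [&& I \subset S, indep I & u \notin I]) F I =
  \sum_(I : {set G} | (I \subset S :\ u) && indep I) F I.
Proof.
apply: eq_bigl => I; rewrite andbA andbAC; congr (_ && _).
by rewrite subsetD disjoint_sym disjoints1.
Qed.

Lemma part_fun_in S u : u \in S ->
  \sum_(I : {set G} | [&& I \subset S, indep I & u \in I]) lambda ^+ #|I| =
  lambda * part_fun (S :\: closed_nbhd u).
Proof.
move=> uS; rewrite indep_sum_in // mulr_sumr; apply: eq_bigr => I.
rewrite subsetD disjoint_sym disjoints_subset => /andP[/andP[_ /subsetP uI] _].
have {}uI : u \notin I by have := uI u; rewrite !inE eqxx; apply.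
by rewrite cardsU1 uI exprS.
Qed.

Lemma part_fun_del S u : u \in S ->
  part_fun S = part_fun (S :\ u) + lambda * part_fun (S :\: closed_nbhd u).
Proof.
move=> uS; rewrite addrC -part_fun_in // /part_fun -indep_sum_out.
rewrite (bigID (fun I => u \in I)) /=.
by congr (_ + _); apply: eq_bigl => I; rewrite andbA.
Qed.

Definition occ S v : R :=
  (\sum_(I : {set G} | [&& I \subset S, indep I & v \in I]) lambda ^+ #|I|)
  / part_fun S.

(** For u in S this is the odds that u is occupied in G[S].  Only S minus u
    matters, so the formula makes sense for every u. *)
Definition vertex_ratio S u : R :=
  lambda * part_fun (S :\: closed_nbhd u) / part_fun (S :\ u).

Lemma vertex_ratio_ge0 S u : 0 <= vertex_ratio S u.
Proof.
by rewrite ltW // divr_gt0 ?mulr_gt0 ?part_fun_gt0.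
Qed.

Lemma vertex_ratio1D S u : u \in S ->
  1 + vertex_ratio S u = part_fun S / part_fun (S :\ u).
Proof.
move=> uS; rewrite /vertex_ratio [part_fun S](part_fun_del uS) mulrDl.
by rewrite divff // gt_eqF // part_fun_gt0.
Qed.

(** The influence of u on v in G[S]: conditioning on u occupied deletes the
    closed neighbourhood of u, conditioning on u unoccupied deletes u.  The
    value at v = u is 0, as on the diagonal of the influence matrix. *)
Definition del_influence S u v : R :=
  occ (S :\: closed_nbhd u) v - occ (S :\ u) v.

Lemma indep_sum_mem S u v : u \in S -> v != u ->
  \sum_(I : {set G} | [&& I \subset S, indep I & (v \in I) && (u \in I)])
    lambda ^+ #|I| =
  lambda * \sum_(I : {set G} | [&& I \subset S :\: closed_nbhd u, indep I
                              & v \in I]) lambda ^+ #|I|.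
Proof.
move=> uS vu.
have := @indep_sum_in S u (fun I => if v \in I then lambda ^+ #|I| else 0) uS.
rewrite -big_mkcondr /= => h.
transitivity (\sum_(I : {set G} | [&& I \subset S, indep I & u \in I] &&
   (v \in I)) lambda ^+ #|I|).
  by apply: eq_bigl => I; rewrite [(v \in I) && _]andbC !andbA.
rewrite h mulr_sumr [RHS](eq_bigl (fun I : {set G} =>
  ((I \subset S :\: closed_nbhd u) && indep I) && (v \in I))); last first.
  by move=> I; rewrite andbA.
rewrite [RHS]big_mkcondr; apply: eq_bigr => I.
rewrite subsetD disjoint_sym disjoints_subset => /andP[/andP[_ /subsetP uI] _].
have {}uI : u \notin I by have := uI u; rewrite !inE eqxx; apply.
by rewrite !inE (negbTE vu) /= cardsU1 uI exprS.
Qed.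

(** The law on G[S] mixes the two conditional laws given the state of u, with
    weights p and 1 - p for p = r / (1 + r), so deleting u changes the
    occupation probability of v by p times the influence of u. *)
Lemma occ_del S u v : u \in S ->
  occ S v - occ (S :\ u) v =
  vertex_ratio S u / (1 + vertex_ratio S u) *
    ((v == u)%:R + del_influence S u v).
Proof.
move=> uS; rewrite vertex_ratio1D // /vertex_ratio /del_influence.
have Zd := part_fun_del uS.
have := part_fun_gt0 S; have := part_fun_gt0 (S :\ u).
have := part_fun_gt0 (S :\: closed_nbhd u).
rewrite /occ; have [->|vu] := eqVneq v u.
  rewrite part_fun_in // !big_pred0 => [|I|I]; last first.
  - apply/negbTE; rewrite subsetD1; case: (u \in I); rewrite /= ?andbF //.
  - rewrite subsetD disjoint_sym disjoints_subset.
    apply/negbTE/negP => /and3P[/andP[_ /subsetP/(_ u)]].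
    by rewrite !inE eqxx /= => /(_ isT)/negbTE->.
  by move=> ? ? ?; rewrite !mul0r !subr0 addr0 mulr1; field; rewrite !gt_eqF.
rewrite add0r.
have -> :
  \sum_(I : {set G} | [&& I \subset S, indep I & v \in I]) lambda ^+ #|I| =
    lambda * \sum_(I : {set G} | [&& I \subset S :\: closed_nbhd u, indep I
                              & v \in I]) lambda ^+ #|I|
   + \sum_(I : {set G} | [&& I \subset S :\ u, indep I & v \in I])
       lambda ^+ #|I|.
  rewrite -indep_sum_mem // (bigID (fun I => u \in I)) /=; congr (_ + _).
    by apply: eq_bigl => I; rewrite !andbA.
  by apply: eq_bigl => I; rewrite subsetD1 -!andbA; do !bool_congr.
move: Zd; set a := part_fun S; set b := part_fun _; set c := part_fun _.
set d := \sum_(_ | _) _; set e := \sum_(_ | _) _.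
move=> -> c0 b0 a0; field; rewrite !gt_eqF //.
Qed.
End PartitionFunction.

(** * Deleting neighbours in order *)
Section Telescope.
Variables (T : finType) (le : rel T).
Hypothesis le_order : total_order le.

Lemma order_max (N : {set T}) : N != set0 ->
  exists2 m, m \in N & forall x, x \in N -> le x m.
Proof.
have [le_total le_anti le_trans] := le_order.
case/set0Pn => x0 x0N.
have [|y x z lexy leyz|x y||m mN max_m] :=
  @extremumP _ _ (fun x y => le y x) x0 (mem N) id.
- by move=> x; have := le_total x x; rewrite orbb.
- exact: le_trans leyz lexy.
- exact: le_total.
- exact: x0N.
- by exists m.
Qed.

(** The elements of N are removed from S in increasing order, the term at w
    comparing the sets just before and just after the removal of w.  The monoid
    is arbitrary so that the lemma serves quotients of partition functions as
    well as differences of probabilities.  The induction splits off the largest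
    element, which does not alter the terms of the others. *)
Lemma order_telescope (V : Type) (idx : V) (op : Monoid.com_law idx)
    (h : {set T} -> {set T} -> V) (S N : {set T}) :
  (forall A, h A A = idx) ->
  (forall A B C, op (h A B) (h B C) = h A C) ->
  \big[op/idx]_(w in N) h (S :\: [set x in N | le x w & x != w])
                          (S :\: [set x in N | le x w]) =
  h S (S :\: N).
Proof.
have [_ le_anti _] := le_order => hid hop.
elim: {N}#|N| {-2}N (erefl #|N|) => [|n IHn] N.
  by move/eqP; rewrite cards_eq0 => /eqP ->; rewrite big_set0 setD0 hid.
move=> N_n; have [|m mN max_m] := @order_max N.
  by rewrite -card_gt0 N_n.
(* Hence removing m from N changes none of the sets attached to the others. *)
have le_max x : x \in N :\ m -> ~~ le m x.
  rewrite !inE => /andP[xm xN]; apply: contra xm => lemx.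
  by rewrite eq_sym; apply/eqP/le_anti; rewrite lemx max_m.
rewrite (big_setD1 m) //= Monoid.mulmC.
have -> : [set x in N | le x m & x != m] = N :\ m.
  by apply/setP => x; rewrite !inE; case: (boolP (x \in N)) => [/max_m ->|];
     rewrite ?andbF ?andbT.
have -> : [set x in N | le x m] = N.
  by apply/setP => x; rewrite !inE; case: (boolP (x \in N)) => [/max_m ->|].
rewrite -[RHS](hop _ (S :\: (N :\ m))); congr (op _ _).
rewrite -IHn; last by have := cardsD1 m N; rewrite mN N_n => -[].
apply: eq_bigr => w wN; congr (h (_ :\: _) (_ :\: _)); apply/setP => x;
  rewrite !inE; case: (eqVneq x m) => // ->;
  by rewrite (negbTE (le_max _ wN)) ?andbF.
Qed.
End Telescope.

(** * The recursion along the tree of self avoiding walks *)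
Section SawRecursion.
Variables (R : realType) (lambda : R).
Hypothesis lambda_gt0 : 0 < lambda.
Variables (G : sgraph) (le : rel G).
Hypothesis le_order : total_order le.
Implicit Types (S : {set G}) (u v w : G).

Definition saw_children (x : {set G} * G) : seq ({set G} * G) :=
  [seq (saw_rest le x.1 x.2 w, w) |
     w <- enum [pred w | (w \in x.1) && edge x.2 w]].

Definition pair_ratio (x : {set G} * G) : R := vertex_ratio lambda x.1 x.2.

Lemma big_saw_children (V : Type) (idx : V) (op : Monoid.com_law idx) S u
    (f : {set G} * G -> V) :
  \big[op/idx]_(y <- saw_children (S, u)) f y =
  \big[op/idx]_(w | (w \in S) && edge u w) f (saw_rest le S u w, w).
Proof. by rewrite big_map big_enum. Qed.

Lemma saw_telescope (V : Type) (idx : V) (op : Monoid.com_law idx)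
    (h : {set G} -> {set G} -> V) S u :
  (forall A, h A A = idx) ->
  (forall A B C, op (h A B) (h B C) = h A C) ->
  \big[op/idx]_(w | (w \in S) && edge u w)
     h (saw_rest le S u w) (saw_rest le S u w :\ w) =
  h (S :\ u) (S :\: closed_nbhd u).
Proof.
have [le_total _ _] := le_order => hid hop.
have le_refl x : le x x by have := le_total x x; rewrite orbb.
have -> : S :\: closed_nbhd u = (S :\ u) :\: [set w in S | edge u w].
  apply/setP => x; rewrite !inE.
  by case: (x \in S); case: (x == u); case: (edge u x).
rewrite -(@order_telescope _ _ le_order _ idx op) //; apply: eq_big => w.
  by rewrite inE.
case/andP => wS uw; congr (h _ _); apply/setP => x; rewrite !inE.
  by case: (x \in S); case: (x == u); case: (edge u x); case: (le x w);
     case: (x == w).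
have [->|_] := eqVneq x w; first by rewrite wS uw le_refl.
by case: (x \in S); case: (x == u); case: (edge u x); case: (le x w).
Qed.

(** The factor 1 / (1 + r(S_w,w)) is Z(S_w - w) / Z(S_w), and S_w - w is the
    set from which the next neighbour is considered. *)
Lemma pair_ratio_rec x :
  pair_ratio x = ratio_step saw_children lambda pair_ratio x.
Proof.
case: x => S u; rewrite /ratio_step big_saw_children /pair_ratio /=.
rewrite (eq_bigr (fun w => part_fun lambda (saw_rest le S u w :\ w) /
    part_fun lambda (saw_rest le S u w))); last first.
  by move=> w Hw; rewrite vertex_ratio1D ?invf_div // saw_rest_self.
have Z0 := part_fun_gt0 lambda_gt0.
rewrite (@saw_telescope _ _ _
  (fun A B => part_fun lambda B / part_fun lambda A)).
- by rewrite /vertex_ratio mulrA.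
- by move=> A; rewrite divff // gt_eqF.
- by move=> A B C; rewrite /= mulrC mulrA divfK // gt_eqF.
Qed.

(** The influence of u compares S - N[u] with S - u; passing from one to the
    other neighbour by neighbour, each deletion costs what [occ_del] says. *)
Lemma del_influence_rec S u v :
  del_influence lambda S u v =
  - \sum_(w | (w \in S) && edge u w)
      pair_ratio (saw_rest le S u w, w) /
        (1 + pair_ratio (saw_rest le S u w, w)) *
        ((v == w)%:R + del_influence lambda (saw_rest le S u w) w v).
Proof.
rewrite (eq_bigr (fun w => occ lambda (saw_rest le S u w) v -
                          occ lambda (saw_rest le S u w :\ w) v)); last first.
  by move=> w Hw; rewrite occ_del // saw_rest_self.
rewrite (@saw_telescope _ _ _ (fun A B => occ lambda A v - occ lambda B v)).
- by rewrite opprB.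
- by move=> A; rewrite subrr.
- by move=> A B C; rewrite /= addrA subrK.
Qed.

Lemma del_influence_sum_le n S u : u \in S -> (#|S| <= n)%N ->
  \sum_v `|del_influence lambda S u v| <=
  \sum_(l < n) path_weight saw_children pair_ratio l.+1 (S, u).
Proof.
elim: n S u => [|n IHn] S u uS Sn.
  by move: Sn uS; rewrite leqn0 cards_eq0 => /eqP ->; rewrite inE.
pose p w := pair_ratio (saw_rest le S u w, w) /
            (1 + pair_ratio (saw_rest le S u w, w)).
have p0 w : 0 <= p w.
  by rewrite divr_ge0 ?addr_ge0 // vertex_ratio_ge0.
apply: (@le_trans _ _ (\sum_(w | (w \in S) && edge u w) p w *
    (1 + \sum_v `|del_influence lambda (saw_rest le S u w) w v|))).
  rewrite [leRHS](eq_bigr (fun w => \sum_v p w * ((v == w)%:R +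
            `|del_influence lambda (saw_rest le S u w) w v|))); last first.
    move=> w _; rewrite -mulr_sumr big_split /=; congr (_ * (_ + _)).
    by rewrite (bigD1 w) //= eqxx big1 ?addr0 // => i /negbTE ->.
  rewrite exchange_big /=; apply: ler_sum => v _.
  rewrite del_influence_rec normrN; apply: le_trans (ler_norm_sum _ _ _) _.
  apply: ler_sum => w _; rewrite -/(p w) normrM ger0_norm // ler_wpM2l //.
  by apply: le_trans (ler_normD _ _) _; rewrite normr_nat.
rewrite /= [leRHS](eq_bigr (fun l : 'I_n.+1 => \sum_(w | (w \in S) && edge u w)
   p w * path_weight saw_children pair_ratio l (saw_rest le S u w, w)));
  last first.
  by move=> l _; rewrite big_saw_children.
rewrite exchange_big /=; apply: ler_sum => w Hw.
rewrite -mulr_sumr ler_wpM2l //.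
(* The path of length 0 from w accounts for the influence of w on itself. *)
rewrite big_ord_recl /= lerD2l; apply: IHn; first exact: saw_rest_self.
by rewrite -ltnS (leq_trans _ Sn) // card_saw_rest.
Qed.
End SawRecursion.

(** * From row sums of influences to eigenvalues *)
Section Influence.
Variables (R : realType) (lambda : R).
Hypothesis lambda_gt0 : 0 < lambda.

Lemma occE (G : sgraph) (S : {set G}) v :
  occ lambda S v =
  if v \in S then
    lambda * part_fun lambda (S :\: closed_nbhd v) / part_fun lambda S
  else 0.
Proof.
rewrite /occ; case: ifP => vS; first by rewrite part_fun_in.
rewrite big_pred0 ?mul0r // => I; apply/negbTE/negP => /and3P[/subsetP IS _ vI].
by rewrite IS in vS.
Qed.

Lemma influenceE (G : sgraph) (u v : G) : u != v ->
  influence lambda u v = del_influence lambda [set: G] u v.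
Proof.
move=> uv; rewrite /influence /hc_cond_prob /del_influence /occ.
have Z0 := part_fun_gt0 lambda_gt0.
have ZE :
    \sum_(J : {set G} | indep J) lambda ^+ #|J| = part_fun lambda [set: G].
  by apply: eq_bigl => J; rewrite subsetT.
have probE (A : pred {set G}) : hc_prob lambda A =
    (\sum_(I : {set G} | indep I && A I) lambda ^+ #|I|) /
      part_fun lambda [set: G].
  by rewrite /hc_prob /hardcore ZE mulr_suml.
have condE (a b : R) :
    a / part_fun lambda [set: G] / (b / part_fun lambda [set: G]) = a / b.
  by rewrite invf_div mulrA divfK // gt_eqF.
have subT (P : pred {set G}) :
    (fun I : {set G} => indep I && P I) =1
    (fun I : {set G} => [&& I \subset [set: G], indep I & P I]).
  by move=> I; rewrite subsetT.
(* Conditioning on u occupied, a factor lambda cancels. *)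
rewrite !probE !condE; congr (_ - _).
- rewrite (eq_bigl _ _ (subT _)) (eq_bigl _ _ (subT _)) /= part_fun_in ?inE //.
  rewrite [X in X / _](indep_sum_mem _ (u := u)) ?inE 1?eq_sym //.
  by rewrite -mulf_div divff ?gt_eqF // mul1r.
- rewrite !(eq_bigl _ _ (subT _)) /= indep_sum_out; congr (_ / _).
  apply: eq_bigl => I; rewrite subsetT subsetD1 subsetT /=.
  by rewrite andbC -andbA andbC -andbA.
Qed.

Section Embedding.
Variables (H G : sgraph) (f : H -> G).
Hypothesis f_inj : injective f.
Hypothesis f_edge : forall x y, edge (f x) (f y) = edge x y.

Lemma embed_setD (A D : {set H}) (E : {set G}) :
  (forall x, (f x \in E) = (x \in D)) -> f @: (A :\: D) = f @: A :\: E.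
Proof.
move=> ED; apply/setP => w.
apply/imsetP/setDP => [[x /setDP[xA xD] ->]|[/imsetP[x xA ->]]].
  by rewrite imset_f // ED.
by rewrite ED => xD; exists x => //; rewrite inE xD.
Qed.

Lemma embed_closed_nbhd (A : {set H}) u :
  f @: (A :\: closed_nbhd u) = f @: A :\: closed_nbhd (f u).
Proof. by apply: embed_setD => x; rewrite !inE (inj_eq f_inj) f_edge. Qed.

Lemma embed_del (A : {set H}) u : f @: (A :\ u) = f @: A :\ f u.
Proof. by apply: embed_setD => x; rewrite !inE (inj_eq f_inj). Qed.

(** Both sides obey the same deletion recursion, since an induced embedding
    carries closed neighbourhoods to closed neighbourhoods. *)
Lemma part_fun_embed (A : {set H}) :
  part_fun lambda (f @: A) = part_fun lambda A.
Proof.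
elim: {A}#|A| {-2}A (leqnn #|A|) => [|n IHn] A.
  by rewrite leqn0 cards_eq0 => /eqP ->; rewrite imset0 !part_fun0.
have [->|/set0Pn[u uA]] := eqVneq A set0; first by rewrite imset0 !part_fun0.
move=> An; rewrite (part_fun_del _ uA) (part_fun_del _ (imset_f f uA)).
have An' : (#|A :\ u| <= n)%N by move: An; rewrite (cardsD1 u A) uA.
rewrite -embed_del -embed_closed_nbhd !IHn //.
apply: leq_trans An'; apply: subset_leq_card; apply: setDS.
by rewrite sub1set !inE eqxx.
Qed.

Lemma del_influence_embed (A : {set H}) u v :
  del_influence lambda (f @: A) (f u) (f v) = del_influence lambda A u v.
Proof.
have occ_embed (B : {set H}) : occ lambda (f @: B) (f v) = occ lambda B v.
  by rewrite !occE mem_imset // -embed_closed_nbhd !part_fun_embed.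
by rewrite /del_influence -embed_closed_nbhd -embed_del !occ_embed.
Qed.
End Embedding.

Lemma influence_row_sum (G : sgraph) (S : {set G}) (i : 'I_#|induced S|) :
  \sum_j `|influence_matrix (induced S) lambda i j| <=
  \sum_v `|del_influence lambda S (val (enum_val i)) v|.
Proof.
set u := enum_val i.
have S_img : val @: [set: induced S] = S.
  apply/setP => x; apply/imsetP/idP => [[y _ ->]|xS]; first exact: valP y.
  by exists (Sub x xS).
apply: (@le_trans _ _
  (\sum_(v : induced S) `|del_influence lambda S (val u) (val v)|)).
  rewrite [leRHS](reindex (fun j : 'I_#|induced S| => enum_val j)) /=;
    last first.
    by apply: onW_bij; apply: enum_val_bij.
  apply: ler_sum => j _; rewrite mxE; case: eqVneq => [_|ij].
    by rewrite normr0.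
  rewrite influenceE ?(inj_eq enum_val_inj) //.
  have := @del_influence_embed (induced S) G val val_inj
    (fun _ _ => erefl) [set: induced S].
  by rewrite S_img => ->.
rewrite -(big_sub (mem S) (fun v => `|del_influence lambda S (val u) v|)) /=.
by rewrite [leRHS](bigID (mem S)) /= lerDl sumr_ge0.
Qed.
End Influence.

(** Eigenvectors are row vectors here, so row sums are matched with the l1 norm:
    |a| |x|_1 = |x A|_1 <= eta |x|_1. *)
Lemma eigenvalue_le_row_sum (R : realFieldType) n (A : 'M[R]_n) (eta a : R) :
  (forall i, \sum_j `|A i j| <= eta) -> eigenvalue A a -> a <= eta.
Proof.
move=> row_le /eigenvalueP[x xA x0].
have norm_gt0 : 0 < \sum_j `|x 0 j|.
  have [j xj] : exists j, x 0 j != 0 by apply/rV0Pn.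
  by rewrite (bigD1 j) //= ltr_pwDl ?normr_gt0 ?sumr_ge0.
apply: le_trans (ler_norm a) _; rewrite -(ler_pM2r norm_gt0) mulr_sumr.
rewrite (eq_bigr (fun j => `|\sum_i x 0 i * A i j|)); last first.
  by move=> j _; rewrite -normrM; have /rowP/(_ j) := xA; rewrite !mxE => ->.
apply: (@le_trans _ _ (\sum_j \sum_i `|x 0 i| * `|A i j|)).
  apply: ler_sum => j _; apply: le_trans (ler_norm_sum _ _ _) _.
  by apply: ler_sum => i _; rewrite normrM.
rewrite exchange_big mulr_sumr; apply: ler_sum => i _ /=.
by rewrite -mulr_sumr mulrC ler_wpM2r.
Qed.

(** * Boundary conditions on grafted trees *)
Section Free.
Variables (R : realType) (lambda : R).
Hypothesis lambda_gt0 : 0 < lambda.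
Variables (G : sgraph) (s : G -> option bool).
Hypothesis s_bc : boundary_condition s.

(** The vertices that the boundary condition leaves undetermined: not fixed, and
    not blocked by an occupied neighbour.  A boundary condition thus reduces to
    deleting vertices. *)
Definition free_set : {set G} :=
  [set v | (s v == None) && [forall w, edge v w ==> (s w != Some true)]].

Lemma free_indep (I : {set G}) :
  (I \subset ~: bc_dom s) && indep (I :|: bc_in s) =
  (I \subset free_set) && indep I.
Proof.
have /indepP s_in := s_bc.
apply/andP/andP => -[/subsetP IS /indepP Ii]; split.
- apply/subsetP => v vI; have := IS v vI; rewrite !inE negbK => -> /=.
  apply/forall_inP => w vw; apply: contraTN vw => sw.
  by apply: Ii; rewrite !inE ?vI ?sw ?orbT.
- by apply/indepP => v w vI wI; apply: Ii; rewrite inE ?vI ?wI.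
- by apply/subsetP => v /IS; rewrite !inE negbK => /andP[].
- have nbr v w : v \in I -> w \in bc_in s -> ~~ edge v w.
    move=> /IS; rewrite !inE => /andP[_ /forall_inP h] sw.
    by apply/negP => /h; rewrite sw.
  apply/indepP => v w /setUP[vI|vs] /setUP[wI|ws].
  + exact: Ii.
  + exact: nbr.
  + by rewrite edge_sym nbr.
  + exact: s_in.
Qed.

Lemma Z_outE v : Z_out s lambda v = part_fun lambda (free_set :\ v).
Proof.
rewrite /part_fun -indep_sum_out; apply: eq_bigl => I.
by rewrite free_indep andbC andbA.
Qed.

Lemma Z_inE v : Z_in s lambda v =
  if v \in free_set then
    lambda * part_fun lambda (free_set :\: closed_nbhd v)
  else 0.
Proof.
case: ifP => vF.
  rewrite -part_fun_in //; apply: eq_bigl => I.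
  by rewrite free_indep andbC andbA.
rewrite /Z_in big_pred0 // => I; rewrite free_indep; apply/negbTE/negP.
by case/and3P => vI /subsetP/(_ v vI); rewrite vF.
Qed.

(** Also valid when v is fixed or blocked: the ratio is then 0 and deleting v
    does not change the free set. *)
Lemma ratio1D v :
  (1 + ratio s lambda v)^-1 =
  part_fun lambda (free_set :\ v) / part_fun lambda free_set.
Proof.
have Z0 := part_fun_gt0 lambda_gt0.
rewrite /ratio Z_outE Z_inE; case: ifP => vF.
  by rewrite (part_fun_del _ vF) -[RHS]invf_div mulrDl divff ?gt_eqF.
have -> : free_set :\ v = free_set.
  by apply/setDidPl; rewrite disjoint_sym disjoints1 vF.
by rewrite mul0r addr0 invr1 divff // gt_eqF.
Qed.
End Free.

Section GraftRatio.
Variables (R : realType) (lambda : R).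
Hypothesis lambda_gt0 : 0 < lambda.
Variables (I : finType) (T : I -> rgraph).
Local Notation G := (graft T).
Implicit Types (B : {set graft T}).

Definition branch i (x : T i) : graft T :=
  Some (Tagged (fun i => T i : Type) x).

Lemma branch_inj i : injective (@branch i).
Proof.
move=> x y [/eqP].
by rewrite -tag_eqE /tag_eq /= eqxx tagged_asE /= => /eqP.
Qed.

Lemma edge_branch i (x y : T i) : edge (branch x) (branch y) = edge x y.
Proof. by rewrite /edge /= eqxx tagged_asE. Qed.

Lemma edge_branch_neq i j (x : T i) (y : T j) : i != j ->
  edge (branch x) (branch y) = false.
Proof. by rewrite /edge /= => /negbTE ->. Qed.

Definition branch_part B i : {set T i} := [set x | branch x \in B].

(** Independence of the branches, by deleting one vertex at a time: a deletion
    in the branch i, with or without its neighbours, leaves the other branches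
    untouched, so both sides obey the same recursion. *)
Lemma part_fun_graft B : None \notin B ->
  part_fun lambda B = \prod_i part_fun lambda (branch_part B i).
Proof.
elim: {B}#|B| {-2}B (leqnn #|B|) => [|n IHn] B Bn B0.
  move: Bn; rewrite leqn0 cards_eq0 => /eqP ->.
  rewrite part_fun0 big1 // => i _.
  have -> : branch_part set0 i = set0 by apply/setP => x; rewrite !inE.
  by rewrite part_fun0.
have [B_0|/set0Pn[[[i a]|] aB]] := eqVneq B set0; last by rewrite aB in B0.
  by apply: IHn => //; rewrite B_0 cards0.
have smaller (D : {set graft T}) : branch a \in D -> part_fun lambda (B :\: D) =
    \prod_i part_fun lambda (branch_part (B :\: D) i).
  move=> aD; apply: IHn; last by rewrite inE negb_and B0 orbT.
  rewrite -ltnS (leq_trans _ Bn) // [X in (_ < X)%N](cardsD1 (branch a)) aB.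
  by rewrite ltnS subset_leq_card // setDS // sub1set.
rewrite (part_fun_del _ aB) !smaller ?inE ?eqxx //.
rewrite [RHS](bigD1 i) //= !(bigD1 (P := xpredT) i) //=.
have aBi : a \in branch_part B i by rewrite inE.
rewrite (part_fun_del _ aBi).
have same (D : {set T i}) (E : {set graft T}) :
    (forall x, (branch x \in E) = (x \in D)) ->
    branch_part (B :\: E) i = branch_part B i :\: D.
  by move=> ED; apply/setP => x; rewrite !inE ED.
have other (E : {set graft T}) j : (forall x : T j, branch x \notin E) ->
    branch_part (B :\: E) j = branch_part B j.
  by move=> NE; apply/setP => x; rewrite !inE NE.
rewrite (same [set a]); last by move=> x; rewrite !inE (inj_eq (@branch_inj i)).
rewrite (same (closed_nbhd a)); last first.
  by move=> x; rewrite !inE (inj_eq (@branch_inj i)) edge_branch.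
have ne j (x : T j) : j != i -> branch x == branch a = false.
  by move=> ji; apply/negbTE/eqP => -[e _]; rewrite e eqxx in ji.
rewrite mulrDl -[lambda * _ * _]mulrA; congr (_ * _ + _ * (_ * _));
  apply: eq_bigr => j ji; rewrite other // => x; rewrite !inE.
  by rewrite -/(branch a) ne.
by rewrite -/(branch a) ne // edge_branch_neq 1?eq_sym.
Qed.

Section Boundary.
Variable s : graft T -> option bool.
Hypothesis s_bc : boundary_condition s.
Hypothesis s_root : s None = None.

Lemma branch_bc i : boundary_condition (fun x : T i => s (branch x)).
Proof.
have /indepP s_in := s_bc; apply/indepP => x y; rewrite !inE => xs ys.
by rewrite -edge_branch; apply: s_in; rewrite inE.
Qed.

Lemma branch_free i :
  branch_part (free_set s) i = free_set (fun x : T i => s (branch x)).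
Proof.
apply/setP => x; rewrite !inE; congr (_ && _).
apply/forall_inP/forall_inP => h.
  by move=> y xy; apply: h; rewrite edge_branch.
move=> [[j y]|]; last by rewrite s_root.
have [ij|ij] := eqVneq i j; last by rewrite edge_branch_neq.
by subst j; rewrite edge_branch; apply: h.
Qed.

(** The case distinction only concerns children that are fixed to be occupied:
    these block the root.  A child fixed to be unoccupied has ratio 0 and
    contributes the factor 1. *)
Lemma ratio_graft :
  ratio s lambda (root (graft T)) =
  lambda * \prod_i
    (if s (branch (root (T i))) == Some true then 0
     else (1 + ratio (fun x : T i => s (branch x)) lambda (root (T i)))^-1).
Proof.
rewrite /ratio Z_outE // Z_inE //=.
have Z0 := part_fun_gt0 lambda_gt0.
have none_del (D : {set graft T}) : None \in D -> None \notin free_set s :\: D.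
  by rewrite inE => ->.
have [none_free|] := boolP (None \in free_set s); last first.
  rewrite inE s_root eqxx /=.
  move=> /forall_inPn[[[i x]|] //] /= /eqP/= xr /negPn si.
  subst x.
  by rewrite mul0r (bigD1 i) //= si !(mul0r, mulr0).
have not_in i : (s (branch (root (T i))) == Some true) = false.
  move: none_free; rewrite inE s_root eqxx /= => /forall_inP h; apply/negbTE/h.
  by rewrite /edge /= eqxx.
under [in RHS]eq_bigr => i _ do
  rewrite not_in (ratio1D lambda_gt0 (@branch_bc i)) -branch_free.
(* The free set minus the closed neighbourhood of the new root consists of the
   free sets of the branches minus their roots. *)
rewrite prodf_div mulrA; congr (_ * _ / _).
  rewrite part_fun_graft ?none_del ?inE //; apply: eq_bigr => i _.
  by congr part_fun; apply/setP => x; rewrite !inE.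
rewrite part_fun_graft ?none_del ?inE //; apply: eq_bigr => i _.
by congr part_fun; apply/setP => x; rewrite !inE.
Qed.
End Boundary.
End GraftRatio.

(** * Levels of the tree of self avoiding walks *)

(** A local certificate that d is the distance to the root and that the levels
    are independent sets; unlike the spheres themselves it passes easily from
    the branches to a graft. *)
Definition depth_function (T : rgraph) (d : T -> nat) : Prop :=
  [/\ forall x : T, (d x == 0%N) = (x == root T),
      forall x y : T, edge x y -> (d y == (d x).+1) || (d x == (d y).+1) &
      forall y : T, (0 < d y)%N -> exists2 x : T, edge x y & d y = (d x).+1].

Lemma sphere_depth (T : rgraph) (d : T -> nat) l : depth_function d ->
  sphere (root T) l = [set x | d x == l].
Proof.
case=> d_root d_edge d_pred.
have d0 : d (root T) = 0%N by apply/eqP; rewrite d_root.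
have path_le p x : path (@edge T) x p -> (d (last x p) <= d x + size p)%N.
  elim: p x => [|y p IHp] x /=; first by rewrite addn0.
  case/andP=> /d_edge xy /IHp/leq_trans; apply; rewrite -addSnnS leq_add2r.
  by case/orP: xy => /eqP ->; rewrite ?leqnn // -addn2 leq_addr.
have walk_le k x : walk k (root T) x -> (d x <= k)%N.
  by case/existsP=> p /andP[/path_le + /eqP <-]; rewrite d0 size_tuple.
have walk_d k x : d x = k -> walk k (root T) x.
  elim: k x => [|k IHk] x dx; apply/existsP.
    by exists [tuple] => /=; rewrite eq_sym -d_root dx.
  have [|y yx] := d_pred x; first by rewrite dx.
  rewrite dx => -[/esym/IHk/existsP[p /andP[pp /eqP py]]].
  exists [tuple of rcons p x].
  by rewrite /= rcons_path pp py yx last_rcons eqxx.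
apply/setP => x; rewrite !inE.
apply/andP/eqP => [[/walk_le xl /forallP no_less]|<-].
  apply/eqP; rewrite eqn_leq xl leqNgt; apply/negP => lt_l.
  by have := no_less (Ordinal lt_l); rewrite /= walk_d.
split; first exact: walk_d.
apply/forallP => -[k kd] /=; apply/negP => /walk_le.
by rewrite leqNgt kd.
Qed.

Definition level_bc (T : rgraph) (d : T -> nat) (b : bool) (l : nat) :
    T -> option bool :=
  fun x => if d x == l then Some b else None.

Lemma level_bcP (T : rgraph) (d : T -> nat) b l : depth_function d ->
  boundary_condition (level_bc d b l) /\
  bc_dom (level_bc d b l) = sphere (root T) l.
Proof.
move=> dP; have [_ d_edge _] := dP; split; last first.
  rewrite (sphere_depth l dP); apply/setP => x; rewrite !inE /level_bc.
  by case: (d x == l).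
apply/indepP => x y; rewrite !inE /level_bc.
case: (d x =P l) => // dx _; case: (d y =P l) => // dy _; apply/negP => /d_edge.
by rewrite dx dy => /orP[] /eqP/n_Sn.
Qed.

(** At level 0 the root of the branch is itself fixed, which is where the base
    case of the recursion comes from. *)
Lemma level_factor (R : realType) (lambda : R) (T : rgraph) (d : T -> nat) b l :
  0 < lambda -> depth_function d ->
  (if level_bc d b l (root T) == Some true then 0
   else (1 + ratio (level_bc d b l) lambda (root T))^-1) =
  if l is 0 then (~~ b)%:R
  else (1 + ratio (level_bc d b l) lambda (root T))^-1.
Proof.
move=> lambda_gt0 dP; have [s_bc _] := level_bcP b l dP.
have [d_root _ _] := dP.
have d0 : d (root T) = 0%N by apply/eqP; rewrite d_root.
case: l s_bc => [|l] s_bc; rewrite {1}/level_bc d0 //=.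
case: b s_bc => //= s_bc; rewrite /ratio Z_inE // inE {1}/level_bc d0 /=.
by rewrite mul0r addr0 invr1.
Qed.

Section SawDepth.
Variables (G : sgraph) (le : rel G).

(** The branches in the recursive definition of the tree, as a family that the
    lemmas on grafts can be applied to. *)
Definition child_tree n S v (w : saw_nbr S v) : rgraph :=
  saw_rec le n (saw_rest le S v (val w)) (val w).

Fixpoint saw_depth (n : nat) (S : {set G}) (v : G) : saw_rec le n S v -> nat :=
  match n return saw_rec le n S v -> nat with
  | 0 => fun=> 0%N
  | n'.+1 => fun x =>
      if x is Some y then (saw_depth (tagged y)).+1 else 0%N
  end.

Lemma saw_depthP n S v : depth_function (@saw_depth n S v).
Proof.
elim: n S v => [|n IHn] S v /=.
  by split=> // -[[[]]|] // [[[]]|].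
split=> [[[i x]|]||] //=.
- move=> [[i x]|] [[j y]|] //=.
  + case: eqP => //= ij; subst j; rewrite tagged_asE !eqSS.
    by have [_ h _] := IHn (saw_rest le S v (val i)) (val i); apply: h.
  + have [h _ _] := IHn (saw_rest le S v (val i)) (val i).
    by rewrite eqSS h => ->.
  + have [h _ _] := IHn (saw_rest le S v (val j)) (val j).
    by rewrite eqSS h => ->.
- move=> [[i y]|] //= _.
  have [h0 _ h] := IHn (saw_rest le S v (val i)) (val i).
  have [y0|/h[x xy dy]] := posnP (saw_depth y).
    by exists None; rewrite /= ?y0 // -h0 y0.
  exists (@branch _ (@child_tree n S v) i x); last by rewrite /= dy.
  exact: etrans (@edge_branch _ (@child_tree n S v) i x y) xy.
Qed.

Variables (R : realType) (lambda : R).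
Hypothesis lambda_gt0 : 0 < lambda.

(** Restricted to a branch, the condition at depth l + 1 of a graft is the
    condition at depth l of that branch. *)
Lemma ratio_saw_level n (S : {set G}) (v : G) b l : v \in S -> (#|S| <= n)%N ->
  ratio (level_bc (@saw_depth n S v) b l.+1) lambda (root (saw_rec le n S v)) =
  level_ratio (saw_children le) lambda b l (S, v).
Proof.
elim: n S v l => [|n IHn] S v l vS Sn.
  by move: Sn vS; rewrite leqn0 cards_eq0 => /eqP ->; rewrite inE.
have [s_bc _] := level_bcP b l.+1 (saw_depthP n.+1 S v).
rewrite [LHS](ratio_graft (T := child_tree n (v := v)) lambda_gt0 s_bc) //.
rewrite (eq_bigr (fun w : saw_nbr S v =>
  if l is l'.+1 then
    (1 + level_ratio (saw_children le) lambda b l'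
           (saw_rest le S v (val w), val w))^-1
  else (~~ b)%:R)); last first.
  move=> w _.
  have -> : (fun x : child_tree n w =>
      level_bc (@saw_depth n.+1 S v) b l.+1
        (@branch _ (@child_tree n S v) w x)) =
      level_bc (@saw_depth n (saw_rest le S v (val w)) (val w)) b l.
    by apply/funext => x; rewrite /level_bc /= eqSS.
  rewrite [X in X == Some true](_ : _ =
    level_bc (@saw_depth n (saw_rest le S v (val w)) (val w)) b l (root _));
    last first.
    by rewrite /level_bc /= eqSS.
  rewrite (level_factor _ _ lambda_gt0 (saw_depthP _ _ _)).
  case: l {s_bc} => // l; rewrite IHn //; first exact: saw_rest_self (valP w).
  by rewrite -ltnS (leq_trans _ Sn) // card_saw_rest.
have E (f : {set G} * G -> R) :
    \prod_(w : saw_nbr S v) f (saw_rest le S v (val w), val w) =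
    \prod_(y <- saw_children le (S, v)) f y.
  rewrite big_saw_children.
  by rewrite (big_sub [pred w | (w \in S) && edge v w]
                      (fun w => f (saw_rest le S v w, w))).
case: l {s_bc} => [|l] /=; first by rewrite (E (fun=> (~~ b)%:R)).
by rewrite (E (fun y => (1 + level_ratio (saw_children le) lambda b l y)^-1)).
Qed.
End SawDepth.

(** The tree at u does not depend on whether u belongs to S.  Mixing is only
    available for u in S, whereas the abstract recursion quantifies over all
    pairs. *)
Lemma saw_children_setU1 (G : sgraph) (le : rel G) (S : {set G}) (u : G) :
  saw_children le (S, u) = saw_children le (u |: S, u).
Proof.
rewrite /saw_children /=.
have -> : enum [pred w | (w \in u |: S) && edge u w] =
          enum [pred w | (w \in S) && edge u w].
  apply: eq_enum => w; rewrite !inE.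
  by case: eqVneq => // ->; rewrite edge_irr !andbF.
apply: eq_map => w; congr (_, _); apply/setP => x; rewrite !inE.
by case: (x == u); rewrite ?andbF.
Qed.

Lemma level_ratio_setU1 (R : realType) (lambda : R) (G : sgraph) (le : rel G)
    b l (S : {set G}) (u : G) :
  level_ratio (saw_children le) lambda b l (S, u) =
  level_ratio (saw_children le) lambda b l (u |: S, u).
Proof. by case: l => [|l] /=; rewrite /ratio_step -saw_children_setU1. Qed.

Lemma saw_children_size (G : sgraph) (le : rel G) Delta x :
  max_degree_le G Delta -> (size (saw_children le x) <= Delta)%N.
Proof.
move=> deg; rewrite size_map -cardE; apply: leq_trans (deg x.2).
by apply: subset_leq_card; apply/subsetP => w; rewrite !inE => /andP[].
Qed.

Theorem corollary11 (R : realType) (Delta : nat) (lambda : R)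
    (F : sgraph -> Prop) (le : forall G : sgraph, rel G)
    (Delta_gt0 : (0 < Delta)%N)
    (lambda_gt0 : 0 < lambda)
    (le_order : forall G : sgraph, total_order (le G))
    (F_degree : forall G : sgraph, F G -> max_degree_le G Delta)
    (F_VSSM : VSSM F le lambda) :
  spectrally_independent F lambda.
Proof.
have [alpha [C [alpha_ge0 alpha_lt1 C_gt0 mixing]]] := F_VSSM.
exists (influence_bound lambda Delta alpha C); split.
  exact: influence_bound_gt0.
move=> G S a FG; apply: eigenvalue_le_row_sum => i.
apply: le_trans (influence_row_sum lambda_gt0 i) _.
have row_le := del_influence_sum_le lambda_gt0 (le_order G).
apply: le_trans (row_le _ _ _ (valP _) (leqnn _)) _.
apply: path_weight_sum => //.
- by move=> x; apply: vertex_ratio_ge0.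
- exact: pair_ratio_rec.
- by move=> x; apply/saw_children_size/F_degree.
(* Mixing at distance l + 1, for the subgraph induced by A and u. *)
move=> l [A u]; rewrite !(level_ratio_setU1 _ _ _ _ A).
have uA := setU11 u A.
rewrite -!(ratio_saw_level (le G) lambda_gt0 _ _ uA (leqnn _)).
have dP := saw_depthP (le G) #|u |: A| (u |: A) u.
have [bc0 dom0] := level_bcP false l.+1 dP.
have [bc1 dom1] := level_bcP true l.+1 dP.
exact: mixing.
Qed.
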